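(* Let $A(t)\in\mathbb{R}^{m\times d}$ ($t\ge0$) be a differentiable time-varying matrix of full row rank with minimum singular value $\sigma_{\min}(t)$ and with $\|A'(t)\|\le G_A$; let $b(t)\in\mathbb{R}^m$ be a differentiable time-varying vector with $\|b'(t)\|\le G_B$; and let $f_1:\mathbb{R}^m\to\mathbb{R}$ be differentiable. Define $f(x;t)=f_1(A(t)x+b(t))$ for $x\in\mathbb{R}^d$. Then, whenever $\|x\|\le R$ (and $\nabla_x f(x;t)\ne0$), $$\frac{|\nabla_t f(x;t)|}{\|\nabla_x f(x;t)\|}\le\frac{G_AR+G_B}{\sigma_{\min}(t)}.$$
   Context: $\nabla_x$ is the gradient in $x$ and $\nabla_t$ the derivative in $t$. The minimum singular value of a full-row-rank $m\times d$ matrix is the smallest of its $m$ (positive) singular values. $\|\cdot\|$ is the Euclidean norm for vectors and the operator norm for matrices. $G_A,G_B,R\ge0$ are constants. *)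

(* Defs.v *)
From HB Require Import structures.
From mathcomp Require Import all_boot all_order all_algebra.
From mathcomp Require Import all_classical all_reals all_analysis.

Set Implicit Arguments.
Unset Strict Implicit.
Unset Printing Implicit Defensive.
Import Order.TTheory GRing.Theory Num.Theory.
Import numFieldNormedType.Exports.

Local Open Scope classical_set_scope.
Local Open Scope ring_scope.

(* The library norm `|v| on matrices and vectors is the sup norm, so the
   Euclidean norm and its operator norm are defined separately.  The topologies
   agree, hence limits and [differentiable] are unaffected. *)
Definition enorm (R : realType) (n : nat) (v : 'cV[R]_n) : R :=
  Num.sqrt (\sum_i v i 0 ^+ 2).

Definition opnorm (R : realType) (m d : nat) (M : 'M[R]_(m, d)) : R :=
  sup [set enorm (M *m x) | x in [set x : 'cV[R]_d | enorm x <= 1]].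

(* The m singular values of an m x d matrix of full row rank (so m <= d) are
   the square roots of the eigenvalues of the m x m Gram matrix A A^T; using
   A^T A would add spurious zeros when m < d. *)
Definition singular_values (R : realType) (m d : nat) (A : 'M[R]_(m, d)) :
    set R :=
  [set Num.sqrt a | a in [set a : R | eigenvalue (A *m A^T) a]].

(* This set is finite, and nonempty for m > 0, so its infimum is its minimum. *)
Definition min_singular_value (R : realType) (m d : nat) (A : 'M[R]_(m, d)) :
    R :=
  inf (singular_values A).

Definition gradient (R : realType) (d : nat) (g : 'cV[R]_d -> R) (x : 'cV[R]_d) :
    'cV[R]_d :=
  \col_i 'D_(delta_mx i 0) g x.

(* Differentiation in time on [0, +oo[: increments h != 0 are restricted to
   those with 0 <= t + h.  For t > 0 this is the usual derivative, at t = 0 it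
   is the right derivative; values at negative times play no role. *)
Definition time_increments (R : realType) (t : R) : set_system R :=
  within [set h : R | 0 <= t + h] (0 : R)^'.

Definition time_quotient (R : realType) (V : normedModType R) (g : R -> V)
    (t h : R) : V :=
  h^-1 *: (g (t + h) - g t).

Definition time_derivable (R : realType) (V : normedModType R) (g : R -> V)
    (t : R) : Prop :=
  cvg (time_quotient g t @ time_increments t).

Definition time_derive (R : realType) (V : normedModType R) (g : R -> V)
    (t : R) : V :=
  lim (time_quotient g t @ time_increments t).

(* Main.v *)
(** With [y = A(t) x + b(t)] and [g] the gradient of [f1] at [y], the chain rule
    gives [grad_x f = A^T g] and [d/dt f = <g, A' x + b'>], whence
    [|d/dt f| <= |g| (GA r + GB)] by Cauchy-Schwarz.  It remains to see that
    [sigma_min |g| <= |A^T g|]: the best [a] such that [a |u|^2 <= |A^T u|^2]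
    for all [u] is an eigenvalue of [A A^T], hence its least one. *)

Require Import Defs.
From HB Require Import structures.
From mathcomp Require Import all_boot all_order all_algebra.
From mathcomp Require Import all_classical all_reals all_analysis.
From mathcomp Require Import ring lra.

Set Implicit Arguments.
Unset Strict Implicit.
Unset Printing Implicit Defensive.
Import Order.TTheory GRing.Theory Num.Theory.
Import numFieldNormedType.Exports.

Local Open Scope classical_set_scope.
Local Open Scope ring_scope.

Definition bform (R : realType) (n : nat) (B : 'M[R]_n) (u v : 'cV[R]_n) : R :=
  (u^T *m B *m v) 0 0.

Section BilinearForm.
Context {R : realType} {n : nat}.
Implicit Types (B : 'M[R]_n) (u v w : 'cV[R]_n).

Lemma bformDl B u v w : bform B (u + v) w = bform B u w + bform B v w.
Proof. by rewrite /bform linearD /= !mulmxDl !mxE. Qed.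

Lemma bformDr B u v w : bform B u (v + w) = bform B u v + bform B u w.
Proof. by rewrite /bform mulmxDr !mxE. Qed.

Lemma bformZl B c u v : bform B (c *: u) v = c * bform B u v.
Proof. by rewrite /bform linearZ /= -!scalemxAl !mxE. Qed.

Lemma bformZr B c u v : bform B u (c *: v) = c * bform B u v.
Proof. by rewrite /bform -!scalemxAr !mxE. Qed.

Lemma bformC B u v : B^T = B -> bform B u v = bform B v u.
Proof.
move=> symB; rewrite /bform -[in LHS](trmxK (u^T *m B *m v)) mxE.
by rewrite !trmx_mul symB trmxK mulmxA.
Qed.

Lemma bform_CauchySchwarz B u v : B^T = B -> (forall w, 0 <= bform B w w) ->
  bform B u v ^+ 2 <= bform B u u * bform B v v.
Proof.
move=> symB posB.
have expand s t : 0 <= s ^+ 2 * bform B u u + 2 * s * t * bform B u v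
                       + t ^+ 2 * bform B v v.
  have := posB (s *: u + t *: v).
  by rewrite !(bformDl, bformDr, bformZl, bformZr) (bformC v u symB); lra.
have u0 := posB u; have v0 := posB v; move: expand u0 v0.
move: (bform B u u) (bform B u v) (bform B v v) => a b c expand a0 c0.
have [c1|c1] := ltP 0 c.
  have := expand c (- b).
  have -> : c ^+ 2 * a + 2 * c * (- b) * b + (- b) ^+ 2 * c
      = c * (a * c - b ^+ 2) by ring.
  by rewrite pmulr_rge0 // subr_ge0.
have {c1 expand} E s t : 0 <= s ^+ 2 * a + 2 * s * t * b.
  have := expand s t; have -> : c = 0 by apply/eqP; rewrite eq_le c1 c0.
  by rewrite mulr0 addr0.
have -> : b = 0; last by rewrite expr0n /= mulr_ge0.
have := E b (- (a + 1)).
have -> : b ^+ 2 * a + 2 * b * (- (a + 1)) * b = - ((a + 2) * b ^+ 2) by ring.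
rewrite oppr_ge0 pmulr_rle0; last by lra.
by move=> b2; apply/eqP; rewrite -sqrf_eq0 eq_le b2 sqr_ge0.
Qed.

Lemma bform1E u : bform 1%:M u u = enorm u ^+ 2.
Proof.
rewrite /bform mulmx1 sqr_sqrtr; last first.
  by apply: sumr_ge0 => i _; rewrite sqr_ge0.
by rewrite mxE; apply: eq_bigr => i _; rewrite mxE expr2.
Qed.

Lemma enorm_ge0 u : 0 <= enorm u.
Proof. exact: sqrtr_ge0. Qed.

Lemma enorm_eq0 u : (enorm u == 0) = (u == 0).
Proof.
apply/idP/eqP => [|->]; last first.
  by rewrite /enorm big1 ?sqrtr0 // => i _; rewrite mxE expr0n.
rewrite -sqrf_eq0 -bform1E /bform mulmx1 mxE psumr_eq0; last first.
  by move=> i _; rewrite mxE -expr2 sqr_ge0.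
move=> /allP u0; apply/matrixP => i j; rewrite ord1 mxE; apply/eqP.
by have := u0 i (mem_index_enum _); rewrite mxE mulf_eq0 orbb.
Qed.

Lemma enorm0 : enorm (0 : 'cV[R]_n) = 0.
Proof. by apply/eqP; rewrite enorm_eq0. Qed.

Lemma enorm_gt0 u : (0 < enorm u) = (u != 0).
Proof. by rewrite lt_def enorm_ge0 andbT enorm_eq0. Qed.

Lemma enormZ c u : enorm (c *: u) = `|c| * enorm u.
Proof.
apply/eqP; rewrite -(eqrXn2 (n := 2)) ?mulr_ge0 ?enorm_ge0 //.
by rewrite exprMn real_normK ?num_real // -!bform1E bformZl bformZr mulrA expr2.
Qed.

Lemma enorm_CauchySchwarz u v : `|bform 1%:M u v| <= enorm u * enorm v.
Proof.
rewrite -(ler_pXn2r (n := 2)) ?nnegrE ?mulr_ge0 ?enorm_ge0 //.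
rewrite exprMn real_normK ?num_real // -!bform1E.
by apply: bform_CauchySchwarz => [|w]; rewrite ?trmx1 // bform1E sqr_ge0.
Qed.

Lemma enormD u v : enorm (u + v) <= enorm u + enorm v.
Proof.
rewrite -(ler_pXn2r (n := 2)) ?nnegrE ?addr_ge0 ?enorm_ge0 //.
have := le_trans (ler_norm _) (enorm_CauchySchwarz u v).
rewrite -bform1E !(bformDl, bformDr) (bformC v u (trmx1 _ _)) !bform1E.
by move=> ?; lra.
Qed.

End BilinearForm.

Lemma enorm_mulmx (R : realType) (m d : nat) (M : 'M[R]_(m, d)) (x : 'cV[R]_d) :
  enorm (M *m x) <= opnorm M * enorm x.
Proof.
have ubM : has_ubound [set enorm (M *m x) | x in [set x | enorm x <= 1]].
  exists (Num.sqrt (\sum_i enorm (row i M)^T ^+ 2)) => _ [y /= y1 <-].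
  rewrite ler_wsqrtr // ler_sum // => i _.
  have -> : (M *m y) i 0 = bform 1%:M (row i M)^T y.
    by rewrite /bform mulmx1 trmxK -row_mul [RHS]mxE.
  rewrite -[leLHS]real_normK ?num_real //.
  rewrite ler_pXn2r ?nnegrE ?enorm_ge0 //.
  apply: le_trans (enorm_CauchySchwarz _ _) _.
  by rewrite -[leRHS]mulr1 ler_wpM2l // enorm_ge0.
have [->|x0] := eqVneq x 0.
  by rewrite mulmx0 !enorm0 mulr0.
have nx : 0 < enorm x by rewrite enorm_gt0 x0.
rewrite -ler_pdivrMr //; apply: (ub_le_sup ubM) => /=.
exists ((enorm x)^-1 *: x) => /=.
  by rewrite enormZ ger0_norm ?invr_ge0 ?enorm_ge0 // mulVf // gt_eqF.
by rewrite -scalemxAr enormZ ger0_norm ?invr_ge0 ?enorm_ge0 // mulrC.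
Qed.

Lemma bform_subscalar (R : realType) (m : nat) (S : 'M[R]_m) (a : R)
    (u : 'cV[R]_m) :
  bform (S - a%:M) u u = bform S u u - a * enorm u ^+ 2.
Proof.
rewrite -bform1E /bform mulmxBr mulmxBl mul_mx_scalar -scalemxAl mulmx1 mxE.
by congr (_ + _); rewrite mxE [in LHS]mxE.
Qed.

(* If the positive semidefinite [S - a] were invertible, Cauchy-Schwarz for its
   form would give [|u|^4 <= <u, (S - a) u> <u, (S - a)^-1 u>], so that the
   infimum [a] could be increased. *)
Lemma rayleigh_inf_eigenvalue (R : realType) (m : nat) (S : 'M[R]_m) (a : R) :
  S^T = S ->
  (forall u, a * enorm u ^+ 2 <= bform S u u) ->
  (forall b, (forall u, b * enorm u ^+ 2 <= bform S u u) -> b <= a) ->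
  eigenvalue S a.
Proof.
move=> symS lba maxa; rewrite /eigenvalue /eigenspace kermx_eq0 row_free_unit.
set B := S - a%:M; apply/negP => unitB.
have symB : B^T = B by rewrite /B linearB /= symS tr_scalar_mx.
have posB u : 0 <= bform B u u by rewrite bform_subscalar subr_ge0.
pose c := `|opnorm (invmx B)| + 1.
have c0 : 0 < c by rewrite /c ltr_pwDr.
have := maxa (a + c^-1); suff lbc u : (a + c^-1) * enorm u ^+ 2 <= bform S u u.
  by move=> /(_ lbc); rewrite gerDl leNgt invr_gt0 c0.
rewrite mulrDl -lerBrDl -bform_subscalar -/B.
have [->|u0] := eqVneq u 0.
  by rewrite enorm0 expr0n mulr0.
have nu : 0 < enorm u by rewrite enorm_gt0 u0.
rewrite ler_pdivrMl //.
have := bform_CauchySchwarz u (invmx B *m u) symB posB.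
have -> : bform B u (invmx B *m u) = enorm u ^+ 2.
  by rewrite -bform1E /bform mulmx1 -!mulmxA mulKVmx.
have -> : bform B (invmx B *m u) (invmx B *m u) = bform 1%:M (invmx B *m u) u.
  by rewrite /bform mulmx1 -!mulmxA mulKVmx.
move=> CS.
have le_c : bform 1%:M (invmx B *m u) u <= c * enorm u ^+ 2.
  apply: le_trans (le_trans (ler_norm _) (enorm_CauchySchwarz _ _)) _.
  rewrite expr2 mulrA ler_wpM2r ?enorm_ge0 //.
  apply: le_trans (enorm_mulmx _ _) _; rewrite ler_wpM2r ?enorm_ge0 //.
  by rewrite (le_trans (ler_norm _)) // /c lerDl.
have := le_trans CS (ler_wpM2l (posB u) le_c).
by rewrite [leLHS]expr2 [leRHS]mulrA ler_pM2r ?exprn_gt0 // mulrC.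
Qed.

Section MinSingularValue.
Context {R : realType} {m d : nat}.
Variable A : 'M[R]_(m, d).
Local Notation gram := (A *m A^T).

Let gram_sym : gram^T = gram.
Proof. by rewrite trmx_mul trmxK. Qed.

Let bform_gram u : bform gram u u = enorm (A^T *m u) ^+ 2.
Proof. by rewrite -bform1E /bform mulmx1 trmx_mul trmxK !mulmxA. Qed.

Lemma singular_values_ge0 s : singular_values A s -> 0 <= s.
Proof. by case=> a _ <-; rewrite sqrtr_ge0. Qed.

Lemma min_singular_valueP : (0 < m)%N ->
  exists2 a, eigenvalue gram a & [/\ 0 <= a, min_singular_value A = Num.sqrt a
    & forall u, a * enorm u ^+ 2 <= enorm (A^T *m u) ^+ 2].
Proof.
move=> m0.
pose E := [set b : R | forall u, b * enorm u ^+ 2 <= bform gram u u].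
pose e : 'cV[R]_m := delta_mx (Ordinal m0) 0.
have ne : 0 < enorm e.
  rewrite enorm_gt0; apply/negP => /eqP/matrixP.
  by move=> /(_ (Ordinal m0) 0); rewrite !mxE !eqxx => /eqP; rewrite oner_eq0.
have E0 : E 0 by move=> u; rewrite mul0r bform_gram sqr_ge0.
have ubE : has_ubound E.
  exists (bform gram e e / enorm e ^+ 2) => b /(_ e).
  by rewrite -ler_pdivlMr // exprn_gt0.
have supE : E (sup E).
  move=> u; have [->|u0] := eqVneq u 0.
    by rewrite enorm0 expr0n mulr0 bform_gram sqr_ge0.
  have nu : 0 < enorm u by rewrite enorm_gt0 u0.
  rewrite -ler_pdivlMr ?exprn_gt0 //; apply: ge_sup; first by exists 0.
  by move=> b /(_ u); rewrite -ler_pdivlMr ?exprn_gt0.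
have eigE : eigenvalue gram (sup E).
  by apply: rayleigh_inf_eigenvalue => // b Eb; exact: ub_le_sup.
exists (sup E) => //; split.
- exact: ub_le_sup.
- apply/eqP; rewrite eq_le; apply/andP; split.
    by apply: ge_inf; [exists 0 => s /singular_values_ge0|exists (sup E)].
  apply: lb_le_inf; first by exists (Num.sqrt (sup E)), (sup E).
  move=> _ [b /= /eigenvalueP[v vb v0] <-]; rewrite ler_wsqrtr //.
  have nv : 0 < enorm v^T. by rewrite enorm_gt0 trmx_eq0.
  rewrite -(ler_pM2r (exprn_gt0 2 nv)) (le_trans (supE _)) //.
  by rewrite -bform1E /bform mulmx1 trmxK vb -scalemxAl mxE.
- by move=> u; rewrite -bform_gram.
Qed.

Lemma min_singular_value_gt0 : (0 < m)%N -> row_free A ->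
  0 < min_singular_value A.
Proof.
move=> /min_singular_valueP[a /eigenvalueP[v va v0] [a0 -> _]] freeA.
rewrite sqrtr_gt0 lt_def a0 andbT; apply: contra_neq v0 => a0'.
have := bform_gram v^T; rewrite /bform trmxK va a0' scale0r mul0mx mxE.
move/esym/eqP; rewrite sqrf_eq0 enorm_eq0 -trmx_mul trmx_eq0.
by rewrite (mulmx_free_eq0 _ freeA) => /eqP.
Qed.

Lemma min_singular_value_mul_enorm (u : 'cV[R]_m) : (0 < m)%N ->
  min_singular_value A * enorm u <= enorm (A^T *m u).
Proof.
move=> /min_singular_valueP[a _ [a0 -> le_a]].
rewrite -(ler_pXn2r (n := 2)) ?nnegrE ?mulr_ge0 ?enorm_ge0 ?sqrtr_ge0 //.
by rewrite exprMn sqr_sqrtr.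
Qed.

End MinSingularValue.

Lemma mulmx_continuous (R : realType) (m d p : nat) (x : 'M[R]_(d, p)) :
  continuous (fun M : 'M[R]_(m, d) => M *m x).
Proof.
have -> : (fun M : 'M[R]_(m, d) => M *m x) =
    fun M => \sum_i \sum_k \sum_j (M i j * x j k) *: delta_mx i k.
  apply/funext => M; rewrite [LHS]matrix_sum_delta.
  apply: eq_bigr => i _; apply: eq_bigr => k _.
  by rewrite mxE scaler_suml.
apply: (continuous_big add_continuous) => i _.
apply: (continuous_big add_continuous) => k _.
apply: (continuous_big add_continuous) => j _ M.
exact: cvgZr_tmp (cvgMr_tmp (@coord_continuous _ _ _ i j M)).
Qed.

Section Gradient.
Context {R : realType}.

Lemma diff_gradient (n : nat) (g : 'cV[R]_n -> R) (y v : 'cV[R]_n) :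
  differentiable g y -> 'd g y v = bform 1%:M (gradient g y) v.
Proof.
move=> dg; rewrite [in LHS](matrix_sum_delta v) linear_sum /bform mulmx1 mxE.
apply: eq_bigr => i _; rewrite big_ord1 linearZ /= !mxE deriveE //.
by rewrite mulrC.
Qed.

Lemma gradient_affine (m d : nat) (g : 'cV[R]_m -> R) (M : 'M[R]_(m, d))
    (c : 'cV[R]_m) (x : 'cV[R]_d) : differentiable g (M *m x + c) ->
  gradient (fun z => g (M *m z + c)) x = M^T *m gradient g (M *m x + c).
Proof.
move=> dg; apply/colP => i; rewrite [LHS]mxE.
have -> : 'D_(delta_mx i 0) (fun z => g (M *m z + c)) x
          = 'D_(M *m delta_mx i 0) g (M *m x + c).
  rewrite /derive [X in fmap X](_ : _ = fun h => h^-1 *: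
    ((g \o shift (M *m x + c)) (h *: (M *m delta_mx i 0)) - g (M *m x + c))) //.
  apply/funext => h /=.
  by rewrite mulmxDr -scalemxAr addrA.
rewrite deriveE // diff_gradient // /bform mulmx1 mulmxA -colE [LHS]mxE.
by rewrite -[_^T *m M]trmxK trmx_mul trmxK [LHS]mxE.
Qed.

End Gradient.

Section TimeDerivative.
Context {R : realType}.
Variable t : R.
Hypothesis t0 : 0 <= t.

Lemma time_increments_proper : ProperFilter (time_increments t).
Proof.
apply: Build_ProperFilter.
move=> /nbhs_ballP[e /= e0] /(_ (e / 2)) /=.
rewrite /ball /= sub0r normrN gtr0_norm ?divr_gt0 // ltr_pdivrMr // mulr_natr.
apply; rewrite ?gt_eqF ?divr_gt0 ?addr_ge0 // ?divr_ge0 ?ltW //.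
by rewrite mulr2n ltrDl.
Qed.

Lemma time_increments_cvg0 : id @ time_increments t --> (0 : R).
Proof. by apply: cvg_within_filter; exact: nbhs_dnbhs. Qed.

Lemma cvg_time_derive (V : normedModType R) (g : R -> V) (l : V) :
  time_quotient g t @ time_increments t --> l -> time_derive g t = l.
Proof.
by move=> gl; have PF := time_increments_proper; exact: cvg_lim gl.
Qed.

Lemma time_quotient_affine_cvg (m d : nat) (A : R -> 'M[R]_(m, d))
    (b : R -> 'cV[R]_m) (x : 'cV[R]_d) : time_derivable A t -> time_derivable b t ->
  time_quotient (fun s => A s *m x + b s) t @ time_increments t -->
  time_derive A t *m x + time_derive b t.
Proof.
have PF := time_increments_proper.
move=> dA db.
have -> : time_quotient (fun s => A s *m x + b s) t =
    (fun h => time_quotient A t h *m x + time_quotient b t h).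
  apply/funext => h; rewrite /time_quotient -scalemxAl -scalerDr mulmxBl.
  by congr (_ *: _); rewrite opprD addrACA.
apply: cvgD => //.
exact: (cvg_comp _ _ dA (@mulmx_continuous R m d 1 x (time_derive A t))).
Qed.

Lemma time_derive_comp (V : normedModType R) (g : V -> R) (y : R -> V) (w : V) :
  time_quotient y t @ time_increments t --> w -> differentiable g (y t) ->
  time_derive (fun s => g (y s)) t = 'd g (y t) w.
Proof.
have PF := time_increments_proper.
move=> yw dg; apply: cvg_time_derive.
have dy h : h != 0 -> y (t + h) = h *: time_quotient y t h + y t.
  by move=> h0; rewrite scalerA divff // scale1r subrK.
have y0 : (fun h => h *: time_quotient y t h) @ time_increments t --> (0 : V).
  by rewrite -(scale0r w); apply: cvgZ time_increments_cvg0 yw.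
have dyw : (fun h => 'd g (y t) (time_quotient y t h)) @ time_increments t -->
    'd g (y t) w.
  have dgc : continuous ('d g (y t)) by exact: diff_continuous.
  exact: (cvg_comp _ _ yw (dgc w)).
apply/cvgrPdist_le => /= e e0.
pose k := `|w| + 1; have k0 : 0 < k by rewrite ltr_wpDl.
have /eqaddoP/(_ (e / 2 / k)) /= := diff_locally dg.
rewrite !divr_gt0 // => /(_ isT) /y0 near_o.
near=> h.
have h0 : h != 0.
  by near: h; rewrite /time_increments; apply: cvg_within; exact: withinT.
have -> : time_quotient (g \o y) t h = 'd g (y t) (time_quotient y t h) +
    h^-1 * (g (y (t + h)) - g (y t) - 'd g (y t) (h *: time_quotient y t h)).
  have -> : 'd g (y t) (h *: time_quotient y t h)
      = h * 'd g (y t) (time_quotient y t h) by exact: linearZ.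
  rewrite [in RHS]mulrBr [h^-1 * (h * _)]mulrA mulVf // mul1r.
  by rewrite addrC subrK.
rewrite opprD addrA (splitr e) (le_trans (ler_normB _ _)) // lerD //.
  by near: h; move/cvgrPdist_le : dyw; apply; rewrite divr_gt0.
rewrite normrM normfV ler_pdivrMl ?normr_gt0 // dy //.
pose q := time_quotient y t h.
have oq : `|g (h *: q + y t) - (g (y t) + 'd g (y t) (h *: q))|
    <= e / 2 / k * `|h *: q|.
  by rewrite /q; near: h; exact: near_o.
have qk : `|q| <= k.
  rewrite -lerBlDl (le_trans (lerB_dist _ _)) // distrC.
  by rewrite /q; near: h; move/cvgrPdist_le : yw; apply.
rewrite opprD addrA in oq; rewrite (le_trans oq) // normrZ mulrCA.
by rewrite ler_pM2l ?normr_gt0 // mulrAC ler_pdivrMr // ler_pM2l ?divr_gt0.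
Unshelve. all: by end_near.
Qed.

End TimeDerivative.

Theorem corollary1 (R : realType) (m d : nat) (GA GB r : R)
    (A : R -> 'M[R]_(m, d)) (b : R -> 'cV[R]_m) (f1 : 'cV[R]_m -> R)
    (hGA : 0 <= GA) (hGB : 0 <= GB) (hr : 0 <= r)
    (A_derivable : forall t : R, 0 <= t -> time_derivable A t)
    (A_full_row_rank : forall t : R, 0 <= t -> row_free (A t))
    (A_rate : forall t : R, 0 <= t -> opnorm (time_derive A t) <= GA)
    (b_derivable : forall t : R, 0 <= t -> time_derivable b t)
    (b_rate : forall t : R, 0 <= t -> enorm (time_derive b t) <= GB)
    (f1_differentiable : forall y : 'cV[R]_m, differentiable f1 y) :
  let f := fun (x : 'cV[R]_d) (t : R) => f1 (A t *m x + b t) in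
  forall (x : 'cV[R]_d) (t : R), 0 <= t -> enorm x <= r ->
    gradient (fun z => f z t) x != 0 ->
    `|time_derive (fun s => f x s) t| / enorm (gradient (fun z => f z t) x)
      <= (GA * r + GB) / min_singular_value (A t).
Proof.
move=> f x t t0 xr grad0.
have d1 := f1_differentiable (A t *m x + b t).
pose g := gradient f1 (A t *m x + b t).
have gradE : gradient (fun z => f z t) x = (A t)^T *m g.
  exact: gradient_affine.
have timeE : time_derive (fun s => f x s) t =
    bform 1%:M g (time_derive A t *m x + time_derive b t).
  rewrite -diff_gradient //.
  apply: (@time_derive_comp _ t t0 _ f1 (fun s => A s *m x + b s)) => //.
  apply: time_quotient_affine_cvg => //; first exact: A_derivable.
  exact: b_derivable.
have m0 : (0 < m)%N.
  rewrite lt0n; apply: contra_neq grad0 => m0; rewrite gradE.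
  suff -> : g = 0 by rewrite mulmx0.
  by apply/colP => i; have := ltn_ord i; rewrite [X in (_ < X)%N]m0.
have sigma0 := min_singular_value_gt0 m0 (A_full_row_rank t t0).
have rate : enorm (time_derive A t *m x + time_derive b t) <= GA * r + GB.
  rewrite (le_trans (enormD _ _)) // lerD ?b_rate //.
  rewrite (le_trans (enorm_mulmx _ _)) //.
  by rewrite (le_trans (ler_wpM2r _ (A_rate t t0))) ?enorm_ge0 // ler_wpM2l.
have K0 : 0 <= GA * r + GB by rewrite addr_ge0 ?mulr_ge0.
rewrite ler_pdivrMr ?enorm_gt0 // mulrAC ler_pdivlMr // timeE.
apply: (@le_trans _ _ (enorm g * (GA * r + GB) * min_singular_value (A t))).
  rewrite ler_wpM2r ?(ltW sigma0) // (le_trans (enorm_CauchySchwarz _ _)) //.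
  by rewrite ler_wpM2l ?enorm_ge0.
rewrite mulrAC mulrC ler_wpM2l // mulrC gradE.
exact: min_singular_value_mul_enorm.
Qed.
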